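(* Let $n\ge 1$, let $A\in\mathbb{C}^{n\times n}$, and set $A_0=I_n$, $A_1=\frac{A+A^*}{2}$, $A_2=\frac{A-A^*}{2i}$. In the affine plane $y_0=1$, identified with $\mathbb{R}^2$, let $$\mathcal{F}(A)=\{(y_1,y_2)\in\mathbb{R}^2 : A_0+y_1A_1+y_2A_2\succeq 0\},\qquad \mathcal{P}=\{(y_1,y_2)\in\mathbb{R}^2 : \det(A_0+y_1A_1+y_2A_2)=0\}.$$ Then $\mathcal{F}(A)$ is the connected component delimited by $\mathcal{P}$ around the origin, i.e. $\mathcal{F}(A)$ is the closure of the connected component of $\mathbb{R}^2\setminus\mathcal{P}$ containing $(0,0)$.
   Context: Here $i$ is the imaginary unit, $I_n$ is the identity matrix of size $n$, $A^*$ is the conjugate transpose, and $M\succeq 0$ means that $M$ is Hermitian positive semidefinite. The matrices $A_0,A_1,A_2$ are Hermitian. *)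

(* Defs.v *)
From HB Require Import structures.
From mathcomp Require Import all_boot all_order all_algebra.
From mathcomp Require Import spectral complex.
From mathcomp Require Import all_classical all_reals all_analysis.

Set Implicit Arguments.
Unset Strict Implicit.
Unset Printing Implicit Defensive.

Import Order.TTheory GRing.Theory Num.Theory.
Import numFieldNormedType.Exports.

Local Open Scope classical_set_scope.
Local Open Scope ring_scope.
Local Open Scope sesquilinear_scope.

(* In the partial order of a numClosedFieldType, [0 <= z] says that z is real
   and nonnegative. *)
Definition psdmx (C : numClosedFieldType) (n : nat) (M : 'M[C]_n) : Prop :=
  M \is hermsymmx /\ forall x : 'cV[C]_n, 0 <= (x ^t* *m M *m x) 0 0.

Section Pencil.
Variables (C : numClosedFieldType) (n : nat) (A : 'M[C]_n).

Definition mxA0 : 'M[C]_n := 1%:M.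
Definition mxA1 : 'M[C]_n := 2^-1 *: (A + A ^t*).
Definition mxA2 : 'M[C]_n := (2 * 'i)^-1 *: (A - A ^t*).

Definition pencil (y1 y2 : C) : 'M[C]_n := mxA0 + y1 *: mxA1 + y2 *: mxA2.

End Pencil.

Section PencilSets.
Variables (R : realType) (n : nat) (A : 'M[R[i]]_n).

Definition spectrahedron : set (R * R) :=
  [set y | psdmx (pencil A (y.1)%:C%C (y.2)%:C%C)].

Definition det_curve : set (R * R) :=
  [set y | \det (pencil A (y.1)%:C%C (y.2)%:C%C) = 0].

End PencilSets.

(* Main.v *)
(** Write M(y) for the pencil.  Its quadratic form is real and affine in y, so
    the spectrahedron F is closed.  If M(y) is positive semidefinite and
    invertible, its eigenvalues are positive, so M(y) >= c I for some c > 0, and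
    this bound persists near y.  Hence F is relatively clopen in the complement
    of the curve, and the component of the origin lies in F.  Conversely, for y
    in F and 0 <= t < 1, M(ty) = (1 - t) I + t M(y) is positive definite, so the
    half-open segment from 0 to y avoids the curve and y is a limit of points of
    the component. *)

Require Import Defs.
From mathcomp Require Import all_boot all_order all_algebra.
From mathcomp Require Import spectral complex.
From mathcomp Require Import all_classical all_reals all_analysis.
From mathcomp Require Import ring lra.

Import Order.TTheory GRing.Theory Num.Theory.
Import numFieldNormedType.Exports.

Local Open Scope classical_set_scope.
Local Open Scope ring_scope.
Local Open Scope sesquilinear_scope.

(** * Quadratic forms of complex matrices and their bounds by the squared norm *)

Section QuadraticForm.
Context {C : numClosedFieldType} {n : nat}.
Implicit Types (M H : 'M[C]_n) (x : 'cV[C]_n).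

Definition qform M x : C := (x ^t* *m M *m x) 0 0.

Lemma qformD M H x : qform (M + H) x = qform M x + qform H x.
Proof. by rewrite /qform mulmxDr mulmxDl mxE. Qed.

Lemma qformZ a M x : qform (a *: M) x = a * qform M x.
Proof. by rewrite /qform -scalemxAr -scalemxAl mxE. Qed.

Lemma qform_sum M x :
  qform M x = \sum_i \sum_j (x i 0)^* * M i j * x j 0.
Proof.
rewrite /qform mxE exchange_big; apply: eq_bigr => j _ /=.
by rewrite mxE mulr_suml; apply: eq_bigr => i _; rewrite !mxE.
Qed.

Lemma qform1 x : qform 1%:M x = \sum_i `|x i 0| ^+ 2.
Proof.
rewrite /qform mulmx1 mxE; apply: eq_bigr => i _.
by rewrite !mxE normCKC.
Qed.

Lemma qform1_ge0 x : 0 <= qform 1%:M x.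
Proof. by rewrite qform1 sumr_ge0 // => i _; rewrite exprn_ge0. Qed.

Lemma qform1_gt0 x : x != 0 -> 0 < qform 1%:M x.
Proof.
move=> x0; rewrite lt_neqAle qform1_ge0 andbT eq_sym qform1.
apply: contra x0; rewrite psumr_eq0; last by move=> i _; rewrite exprn_ge0.
move=> /allP x0; apply/eqP/matrixP => i j; rewrite ord1 mxE.
by have /x0 := mem_index_enum i; rewrite expf_eq0 normr_eq0 => /eqP.
Qed.

Lemma hermsymmxP M : reflect (M ^t* = M) (M \is hermsymmx).
Proof. by rewrite is_hermitianmxE expr0 scale1r eq_sym; exact: eqP. Qed.

Lemma trmxC_mul m1 m2 m3 (B : 'M[C]_(m1, m2)) (D : 'M[C]_(m2, m3)) :
  (B *m D) ^t* = D ^t* *m B ^t*.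
Proof. by rewrite trmx_mul map_mxM. Qed.

Lemma qform_real M x : M \is hermsymmx -> qform M x \is Num.real.
Proof.
move=> /hermsymmxP MH; apply/CrealP.
(* The 1 by 1 matrix [x ^t* *m M *m x] equals its own conjugate transpose. *)
rewrite /qform -[RHS](_ : ((x ^t* *m M *m x) ^t*) 0 0 = _); last first.
  by rewrite !trmxC_mul trmxCK MH mulmxA.
by rewrite !mxE.
Qed.

(** Each product [|x i 0| * |x j 0|] is at most the larger of the two squares, hence at most the
    squared norm; so the sum of the moduli of the entries serves as [k]. *)
Lemma normr_qform_le M :
  exists2 k, 0 <= k & forall x, `|qform M x| <= k * qform 1%:M x.
Proof.
exists (\sum_i \sum_j `|M i j|) => [|x].
  by do 2!apply: sumr_ge0 => ? _.
rewrite qform_sum mulr_suml (le_trans (ler_norm_sum _ _ _))// ler_sum// => i _.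
rewrite mulr_suml (le_trans (ler_norm_sum _ _ _))// ler_sum// => j _.
rewrite !normrM norm_conjC mulrAC mulrC ler_wpM2l//.
have le_qform1 k : `|x k 0| ^+ 2 <= qform 1%:M x.
  by rewrite qform1 (bigD1 k)//= lerDl sumr_ge0.
have [|] := real_leP (normr_real (x i 0)) (normr_real (x j 0)) => [ij|/ltW ij].
  by rewrite (le_trans _ (le_qform1 j))// expr2 ler_wpM2r.
by rewrite (le_trans _ (le_qform1 i))// expr2 ler_wpM2l.
Qed.

(** In an orthonormal eigenbasis the form is a sum of squares weighted by the eigenvalues, which are
    nonnegative by semidefiniteness and nonzero by the determinant. *)
Lemma psdmx_coercive M : psdmx M -> \det M != 0 ->
  exists2 k, 0 <= k & forall x, qform 1%:M x <= k * qform M x.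
Proof.
move=> [MH Mge0] detM.
have Pu := spectral_unitarymx M; set P := spectralmx M in Pu.
have MP : M = P ^t* *m diag_mx (spectral_diag M) *m P.
  rewrite -invmx_unitary//; apply/orthomx_spectralP.
  exact: hermitian_normalmx.
set d := spectral_diag M in MP.
have qM x : qform M x = \sum_i d 0 i * `|(P *m x) i 0| ^+ 2.
  rewrite /qform MP !mulmxA -trmxC_mul -mulmxA mxE; apply: eq_bigr => i _.
  rewrite mul_mx_diag !mxE normCKC [_^* * d 0 i]mulrC mulrA.
  by congr (_ * _); rewrite !mxE.
have q1 x : qform 1%:M x = \sum_i `|(P *m x) i 0| ^+ 2.
  rewrite -qform1 /qform trmxC_mul !mulmx1 mulmxA.
  congr ((_ *m _) 0 0); rewrite -mulmxA -invmx_unitary//.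
  by rewrite mulVmx ?mulmx1// unitarymx_unit.
(* d_i is the value of the form at the i-th eigenvector [P ^t* e_i] *)
have d_ge0 i : 0 <= d 0 i.
  have /unitarymxP PPt := Pu.
  have := Mge0 (P ^t* *m delta_mx i 0); rewrite -/(qform _ _) qM mulmxA.
  rewrite PPt mul1mx (bigD1 i)//= mxE !eqxx normr1 expr1n.
  rewrite mulr1 big1 ?addr0// => j /negPf ji.
  by rewrite mxE ji normr0 expr0n mulr0.
have d_gt0 i : 0 < d 0 i.
  rewrite lt_neqAle d_ge0 andbT eq_sym; apply: contra detM => /eqP di0.
  by rewrite MP !det_mulmx det_diag (bigD1 i)//= di0 !(mul0r, mulr0).
(* Each square is at most [(d 0 i)^-1] times the whole form, because the other terms of the form are
   nonnegative; summing over [i] gives this constant. *)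
exists (\sum_i (d 0 i)^-1) => [|x].
  by apply: sumr_ge0 => i _; rewrite invr_ge0.
rewrite mulr_suml q1 ler_sum// => i _.
rewrite ler_pdivlMl// qM [leRHS](bigD1 i)//= lerDl sumr_ge0// => j _.
by rewrite mulr_ge0.
Qed.

(** If [v *m M = 0] with [v] nonzero, the form vanishes at [v ^t*] while the squared norm there is
    positive. *)
Lemma coercive_det_neq0 k M : (forall x, qform 1%:M x <= k * qform M x) ->
  \det M != 0.
Proof.
move=> Mk; apply/det0P => -[v v0 vM0].
have := Mk (v ^t*); rewrite /qform !trmxCK vM0 mul0mx [X in _ * X]mxE mulr0.
apply/negP; rewrite -real_ltNge ?real0 ?ger0_real//.
  rewrite -{1}[v]trmxCK; apply: qform1_gt0.
  by apply: contra v0 => /eqP v0; rewrite -[v]trmxCK v0 trmx0 map_mx0.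
by rewrite -{1}[v]trmxCK; exact: qform1_ge0.
Qed.

Lemma mxA1_herm (A : 'M[C]_n) : mxA1 A \is hermsymmx.
Proof.
apply/hermsymmxP/matrixP => i j; rewrite /mxA1 !mxE rmorphM rmorphD/= conjCK.
by rewrite fmorphV/= conjC_nat addrC.
Qed.

Lemma mxA2_herm (A : 'M[C]_n) : mxA2 A \is hermsymmx.
Proof.
apply/hermsymmxP/matrixP => i j; rewrite /mxA2 !mxE rmorphM rmorphB/= conjCK.
by rewrite fmorphV/= rmorphM/= conjC_nat conjCi mulrN invrN mulNr -mulrN opprB.
Qed.

Lemma qform_pencil (A : 'M[C]_n) y1 y2 x : qform (pencil A y1 y2) x =
  qform 1%:M x + y1 * qform (mxA1 A) x + y2 * qform (mxA2 A) x.
Proof. by rewrite /pencil !qformD !qformZ. Qed.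

Lemma pencil_herm (A : 'M[C]_n) y1 y2 : y1 \is Num.real -> y2 \is Num.real ->
  pencil A y1 y2 \is hermsymmx.
Proof.
move=> /CrealP y1r /CrealP y2r; apply/hermsymmxP; rewrite /pencil /mxA0.
move: (mxA1 A) (mxA2 A) (mxA1_herm A) (mxA2_herm A) => A1 A2.
move=> /hermsymmxP A1H /hermsymmxP A2H.
rewrite !linearD/= !map_mxD !linearZ/= !map_mxZ trmx1 map_mx1 A1H A2H.
by rewrite /= y1r y2r.
Qed.

End QuadraticForm.

(** * The pencil as a real form, affine in the parameters *)

Section Pencil.
Context {R : realType} {n : nat}.
Context (A : 'M[R[i]]_n).
Implicit Types (x : 'cV[R[i]]_n) (y : R * R).

(** On Hermitian matrices taking the real part loses nothing, and it moves inequalities to [R],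
    where the order is total. *)
Definition Rqform (M : 'M[R[i]]_n) x : R := complex.Re (qform M x).

Lemma RqformE M x : M \is hermsymmx -> qform M x = (Rqform M x)%:C%C.
Proof. by move=> MH; rewrite RRe_real// qform_real. Qed.

Definition pform y x : R :=
  Rqform 1%:M x + y.1 * Rqform (mxA1 A) x + y.2 * Rqform (mxA2 A) x.

Lemma pformE y x :
  qform (pencil A (y.1)%:C%C (y.2)%:C%C) x = (pform y x)%:C%C.
Proof.
rewrite qform_pencil !RqformE ?mxA1_herm ?mxA2_herm ?hermitian1mx_subproof//.
by rewrite -!rmorphM -!rmorphD.
Qed.

Lemma spectrahedronP y : spectrahedron A y <-> forall x, 0 <= pform y x.
Proof.
split=> [[_ yF] x|yF]; first by rewrite -ler0c -pformE; exact: yF.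
split=> [|x]; last by rewrite -/(qform _ _) pformE ler0c.
by rewrite pencil_herm// complex_real.
Qed.

Lemma Rqform1_ge0 x : 0 <= Rqform 1%:M x.
Proof. by rewrite -ler0c -RqformE ?hermitian1mx_subproof// qform1_ge0. Qed.

Lemma normr_Rqform_le M :
  exists2 k, 0 <= k & forall x, `|Rqform M x| <= k * Rqform 1%:M x.
Proof.
have [k k0 Mk] := normr_qform_le M.
exists (complex.Re k) => [|x]; first by rewrite -ler0c RRe_real// ger0_real.
rewrite -lecR rmorphM/= RRe_real ?ger0_real// -RqformE ?hermitian1mx_subproof//.
exact: le_trans (normc_ge_Re _) (Mk x).
Qed.

Lemma spectrahedron_coercive y : spectrahedron A y -> ~ det_curve A y ->
  exists2 c, 0 < c & forall x, c * Rqform 1%:M x <= pform y x.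
Proof.
move=> yF /eqP ydet; have [k k0 yk] := psdmx_coercive _ yF ydet.
have kE : k = (complex.Re k)%:C%C by rewrite RRe_real// ger0_real.
move: k0 yk; rewrite kE; move: (complex.Re k) => {kE}k; rewrite ler0c => k0 yk.
(* Here [k] is only known to be nonnegative; [1 + k] is positive and still a valid bound, as the
   form is nonnegative. *)
exists (1 + k)^-1 => [|x]; first by rewrite invr_gt0 ltr_pwDl.
rewrite ler_pdivrMl ?ltr_pwDl// mulrDl mul1r ler_wpDl//.
  by move: x; apply/spectrahedronP.
by rewrite -lecR rmorphM/= -pformE -RqformE ?hermitian1mx_subproof.
Qed.

Lemma coercive_det_curve c y : 0 < c ->
  (forall x, c * Rqform 1%:M x <= pform y x) -> ~ det_curve A y.
Proof.
move=> c0 yc; apply/eqP; apply: (coercive_det_neq0 (c^-1)%:C%C) => x.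
rewrite pformE RqformE ?hermitian1mx_subproof// -rmorphM/= lecR.
by rewrite ler_pdivlMl.
Qed.

Lemma pform_scale t y x :
  pform (t *: y) x = (1 - t) * Rqform 1%:M x + t * pform y x.
Proof.
rewrite /pform; move: (Rqform _ x) (Rqform _ x) (Rqform _ x) => N a b.
by case: y => y1 y2; rewrite /= /GRing.scale /=; ring.
Qed.

Lemma scale_det_curve t y : spectrahedron A y -> 0 <= t < 1 ->
  ~ det_curve A (t *: y).
Proof.
move=> /spectrahedronP yF /andP[t0 t1].
apply: (coercive_det_curve (1 - t)) => [|x]; first by rewrite subr_gt0.
by rewrite pform_scale lerDl mulr_ge0.
Qed.

Lemma pform_continuous x : continuous (pform ^~ x).
Proof.
move=> y; apply: cvgD; first apply: cvgD.
- exact: cvg_cst.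
- by apply: cvgM; [exact: cvg_fst|exact: cvg_cst].
- by apply: cvgM; [exact: cvg_snd|exact: cvg_cst].
Qed.

(** For each fixed [x] the condition on [y] is a closed affine inequality. *)
Lemma spectrahedron_closed : closed (spectrahedron A).
Proof.
rewrite (_ : spectrahedron A = \bigcap_x [set y | 0 <= pform y x]).
  apply: closed_bigI => x _.
  apply: (@preimage_closed _ _ (pform ^~ x) [set r | 0 <= r]).
    by move=> y _; exact: pform_continuous.
  exact: closed_ge.
apply/seteqP; split=> y; first by move=> /spectrahedronP yF x _; exact: yF.
by move=> yF; apply/spectrahedronP => x; exact: yF.
Qed.

Lemma spectrahedron_interior y : spectrahedron A y -> ~ det_curve A y ->
  interior (spectrahedron A) y.
Proof.
move=> yF ydet; have [c c0 yc] := spectrahedron_coercive _ yF ydet.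
have [k1 k10 k1P] := normr_Rqform_le (mxA1 A).
have [k2 k20 k2P] := normr_Rqform_le (mxA2 A).
(* Moving each coordinate by less than [e] changes the form by at most [e * (k1 + k2)] times the
   squared norm, which [c] dominates; the summand 1 keeps the denominator positive. *)
pose e := c / (1 + k1 + k2).
have k_gt0 : 0 < 1 + k1 + k2 by rewrite -addrA ltr_pwDl// addr_ge0.
have e0 : 0 < e by rewrite divr_gt0.
exists (ball y.1 e, ball y.2 e) => [|z []] /=.
  by split; exact: nbhsx_ballx.
rewrite /ball/= => z1 z2; apply/spectrahedronP => x.
have N0 := Rqform1_ge0 x.
have -> : pform z x = pform y x - (y.1 - z.1) * Rqform (mxA1 A) x
                                - (y.2 - z.2) * Rqform (mxA2 A) x.
  rewrite /pform; move: (Rqform _ x) (Rqform _ x) (Rqform _ x) => N a b.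
  by ring.
have b1 : `|(y.1 - z.1) * Rqform (mxA1 A) x| <= e * (k1 * Rqform 1%:M x).
  by rewrite normrM ler_pM// ltW.
have b2 : `|(y.2 - z.2) * Rqform (mxA2 A) x| <= e * (k2 * Rqform 1%:M x).
  by rewrite normrM ler_pM// ltW.
have := yc x; have -> : c = e * (1 + k1 + k2) by rewrite divfK// gt_eqF.
have := mulr_ge0 (ltW e0) N0.
have := le_trans (ler_norm _) b1; have := le_trans (ler_norm _) b2.
(* Once the products are abstracted, the goal is linear. *)
move: (_ * Rqform (mxA1 A) x) (_ * Rqform (mxA2 A) x) (pform y x) => a b p.
rewrite !mulrDr !mulrDl !mulrA mulr1.
move: (e * _) (e * k1 * _) (e * k2 * _) => c' a' b'.
by clear; lra.
Qed.

End Pencil.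

(** * The component of the origin and its closure *)

Theorem lemma2 (R : realType) (n : nat) (hn : (1 <= n)%N) (A : 'M[R[i]]_n) :
  spectrahedron A = closure (connected_component (~` det_curve A) (0, 0)).
Proof.
apply/seteqP; split=> [y yF|].
  have cvgy : (t *: y) @[t --> 1^'-] --> y.
    apply: cvg_at_left_filter; rewrite -[X in _ --> X]scale1r.
    exact: scalel_continuous.
  apply: (closed_cvg _ _ _ _ cvgy); first exact: closed_closure.
  near=> t; apply: subset_closure.
  have t01 : 0 <= t < 1.
    by apply/andP; split; near: t; [exact: nbhs_left_ge|exact: nbhs_left_lt].
  (* The segment from the origin to [t *: y] is connected and avoids the curve, so its endpoint lies
     in the component. *)
  exists ((fun s : R => s *: y) @` `[0, t]).
    split.
    - by exists 0; [rewrite /= in_itv/= lexx; case/andP: t01|rewrite scale0r].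
    - move=> _ [s /= /[!in_itv]/= /andP[s0 st] <-].
      apply: scale_det_curve => //.
      by rewrite s0 (le_lt_trans st)//; case/andP: t01.
    - apply: connected_continuous_connected; first exact: segment_connected.
      exact/continuous_subspaceT/scalel_continuous.
  by exists t => //; rewrite /= in_itv/= lexx andbT; case/andP: t01.
rewrite [X in _ `<=` X](closure_id _).1; last exact: spectrahedron_closed.
apply: closureS => y [B [B0 BA Bconn] By].
(* A nonempty, relatively open and relatively closed subset of the connected set [B] is all of
   [B]. *)
suff BF : B `&` spectrahedron A = B by move: By; rewrite -BF => -[].
apply: Bconn.
- exists (0, 0); split=> //; apply/spectrahedronP => x.
  have := Rqform1_ge0 x; rewrite /pform.
  move: (Rqform _ x) (Rqform _ x) (Rqform _ x) => N a b /=.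
  by rewrite !mul0r !addr0.
(* Since [B] avoids the curve, it meets the spectrahedron only in interior points. *)
- exists (interior (spectrahedron A)); first exact: open_interior.
  apply/seteqP; split=> z [Bz zF]; split=> //; last exact: interior_subset.
  by apply: spectrahedron_interior => //; exact: BA.
- by exists (spectrahedron A) => //; exact: spectrahedron_closed.
Unshelve. all: by end_near.
Qed.
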